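(* Let $\hat F$ be a regular admissible extended frame on a domain $\Omega\subset\mathbb R^2$, let $F=\hat F|_{\lambda=1}$ and $\nu=\mathrm{Ad}_Fe_3$, and let $\theta\in\mathbb R$, $\theta\ne0$. At every point where $\nu$ is an immersion, the maps $$g^\theta_+=\hat F|_{\lambda=e^{4\theta}}\,\exp(\theta e_3)\,\hat F|_{\lambda=1}^{-1},\qquad g^\theta_-=e_3\,\hat F|_{\lambda=e^{4\theta}}\,e_3\,\exp(\theta e_3)\,\hat F|_{\lambda=1}^{-1}$$ are timelike immersions into $\mathbb H^3_1$ with Gauss map $\nu$ and with $(x,y)$ as asymptotic coordinates, of constant Gaussian curvature $$K_+=\frac1{\sinh^2\theta}>0\qquad\text{and}\qquad K_-=-\frac1{\cosh^2\theta}\in(-1,0)$$ respectively. Every $K\in(-1,0)\cup(0,\infty)$ arises in this way (as $K_+$ or $K_-$ for a suitable $\theta\neq 0$).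
   Context: Ambient space. On the space $\mathfrak{gl}(2,\mathbb R)$ of real $2\times2$ matrices let $\langle X,Y\rangle=-\tfrac12\operatorname{tr}(X\bar Y)$, where $\bar Y=(\operatorname{tr}Y)\mathrm{Id}-Y$ is the adjugate of $Y$; then $\langle X,X\rangle=-\det X$ and the signature is $(2,2)$. Anti-de Sitter 3-space is $\mathbb H^3_1=\{X:\langle X,X\rangle=-1\}=SL(2,\mathbb R)$ with the induced Lorentzian metric. On $\mathfrak{sl}(2,\mathbb R)$ (trace-free matrices) $\langle X,Y\rangle=\tfrac12\operatorname{tr}(XY)$. Put $e_1=\begin{pmatrix}0&-1\\1&0\end{pmatrix}$, $e_2=\begin{pmatrix}0&1\\1&0\end{pmatrix}$, $e_3=\begin{pmatrix}-1&0\\0&1\end{pmatrix}$, $\xi_1=\begin{pmatrix}0&0\\1&0\end{pmatrix}$, $\xi_2=\begin{pmatrix}0&1\\0&0\end{pmatrix}$, $\mathrm{Ad}_FX=FXF^{-1}$, and $\mathbb S^2_1=\{X\in\mathfrak{sl}(2,\mathbb R):\langle X,X\rangle=1\}$. Surfaces. All maps are smooth; a domain $\Omega\subset\mathbb R^2$ is a connected open set with coordinates $(x,y)$. An immersion $f:\Omega\to\mathbb H^3_1$ is timelike if the induced metric $I$ is Lorentzian. A unit normal is $N:\Omega\to\mathfrak{gl}(2,\mathbb R)$ with $\langle N,N\rangle=1$, $\langle N,f\rangle=\langle N,f_x\rangle=\langle N,f_y\rangle=0$; the corresponding Gauss map is $f^{-1}N:\Omega\to\mathbb S^2_1$. The second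 fundamental form has coefficients $L=\langle f_{xx},N\rangle$, $M=\langle f_{xy},N\rangle$, $\mathcal N=\langle f_{yy},N\rangle$. The Gaussian curvature $K$ is given by $K+1=\det II/\det I$ (so $K+1$ is the extrinsic curvature). Coordinates $(x,y)$ are asymptotic if $L=\mathcal N=0$ (and the second fundamental form is Lorentzian). Extended frames. An admissible extended frame on $\Omega$ is a family of maps $\hat F|_\lambda:\Omega\to SL(2,\mathbb R)$, depending smoothly on the spectral parameter $\lambda\in\mathbb R\setminus\{0\}$ (i.e. a map into the loop group $\Lambda SL(2,\mathbb R)$), with $$\hat F^{-1}d\hat F=(\lambda A^1\xi_1+A^2\xi_2+A^3e_3)\,dx+(B^1\xi_1+\lambda^{-1}B^2\xi_2+B^3e_3)\,dy,$$ where $A^i,B^i$ are real functions of $(x,y)$ independent of $\lambda$. It is regular if $A^1\ne0$ and $B^2\ne0$ everywhere on $\Omega$. *)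

(* Defs.v *)
From HB Require Import structures.
From mathcomp Require Import all_boot all_order all_algebra.
From mathcomp Require Import all_classical all_reals all_analysis.

Set Implicit Arguments.
Unset Strict Implicit.
Unset Printing Implicit Defensive.

Import Order.TTheory GRing.Theory Num.Theory numFieldNormedType.Exports.

Local Open Scope classical_set_scope.
Local Open Scope ring_scope.

(* [C_on k U f]: for U open in a finite-dimensional space V, f is C^k on U
   (f differentiable, with every directional derivative again C^(k-1)). *)
Fixpoint C_on (R : realType) (V W : normedModType R) (k : nat) (U : set V)
    (f : V -> W) : Prop :=
  if k is k'.+1 then
    (forall p, U p -> differentiable f p) /\
    (forall v : V, C_on k' U (fun p => 'D_v f p))
  else forall p, U p -> {for p, continuous f}.

Definition smooth_on (R : realType) (V W : normedModType R) (U : set V)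
    (f : V -> W) : Prop := forall k, C_on k U f.

Definition immersion_at (R : realType) (V W : normedModType R)
    (f : V -> W) (p : V) : Prop :=
  differentiable f p /\ injective ('d f p).

Section AntiDeSitter.
Variable R : realType.
Implicit Types (X Y : 'M[R]_2) (U : set 'rV[R]_2) (p : 'rV[R]_2).
Implicit Types (f N nu : 'rV[R]_2 -> 'M[R]_2).

Definition mx2 (a b c d : R) : 'M[R]_2 :=
  \matrix_(i, j) if i == 0 then (if j == 0 then a else b)
                 else (if j == 0 then c else d).

Definition e3 : 'M[R]_2 := mx2 (-1) 0 0 1.
Definition xi1 : 'M[R]_2 := mx2 0 0 1 0.
Definition xi2 : 'M[R]_2 := mx2 0 1 0 0.

Definition ip X Y : R := - 2^-1 * \tr (X *m ((\tr Y)%:M - Y)).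

Definition H31 : set 'M[R]_2 := [set X | ip X X = -1].
Definition S21 : set 'M[R]_2 := [set X | \tr X = 0 /\ ip X X = 1].

Definition Ad X Y : 'M[R]_2 := X *m Y *m invmx X.

(* Matrix exponential series, with limit in the normed space 'M[R]_2. *)
Definition expmx X : 'M[R]_2 :=
  limn (fun n => \sum_(0 <= k < n) (k`!%:R)^-1 *: X ^+ k).

Definition sinh (t : R) : R := (expR t - expR (- t)) / 2.
Definition cosh (t : R) : R := (expR t + expR (- t)) / 2.

(* Points (x, y) of the plane are row vectors; these are the partial
   derivatives f_x and f_y. *)
Definition dx f : 'rV[R]_2 -> 'M[R]_2 := fun p => 'D_(delta_mx 0 0) f p.
Definition dy f : 'rV[R]_2 -> 'M[R]_2 := fun p => 'D_(delta_mx 0 1) f p.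

(* Gram matrix of a symmetric bilinear form of signature (1, 1). *)
Definition lorentzian (B : 'M[R]_2) : Prop :=
  exists2 P : 'M[R]_2, P \in unitmx & P *m B *m P^T = mx2 1 0 0 (-1).

Definition first_form f p : 'M[R]_2 :=
  mx2 (ip (dx f p) (dx f p)) (ip (dx f p) (dy f p))
      (ip (dy f p) (dx f p)) (ip (dy f p) (dy f p)).

Definition coefL f N p : R := ip (dx (dx f) p) (N p).
Definition coefM f N p : R := ip (dy (dx f) p) (N p).
Definition coefN f N p : R := ip (dy (dy f) p) (N p).

Definition second_form f N p : 'M[R]_2 :=
  mx2 (coefL f N p) (coefM f N p) (coefM f N p) (coefN f N p).

Definition immersed_part U f : set 'rV[R]_2 :=
  [set p | U p /\ immersion_at f p].

Definition timelike_immersion U f : Prop :=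
  [/\ smooth_on U f,
      forall p, U p -> H31 (f p),
      forall p, U p -> immersion_at f p &
      forall p, U p -> lorentzian (first_form f p)].

Definition unit_normal U f N : Prop :=
  smooth_on U N /\
  forall p, U p ->
    [/\ ip (N p) (N p) = 1, ip (N p) (f p) = 0,
        ip (N p) (dx f p) = 0 & ip (N p) (dy f p) = 0].

Definition gauss_map U f N nu : Prop :=
  forall p, U p -> nu p = invmx (f p) *m N p /\ S21 (nu p).

Definition asymptotic_coordinates U f N : Prop :=
  forall p, U p ->
    [/\ coefL f N p = 0, coefN f N p = 0 & lorentzian (second_form f N p)].

(* K + 1 = det II / det I (Gauss equation in H31). *)
Definition gaussian_curvature f N p : R :=
  \det (second_form f N p) / \det (first_form f p) - 1.

Definition cgc_surface U f nu (K : R) : Prop :=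
  timelike_immersion U f /\
  exists N, [/\ unit_normal U f N, gauss_map U f N nu,
                asymptotic_coordinates U f N &
                forall p, U p -> gaussian_curvature f N p = K].

Definition plane_domain (Omega : set 'rV[R]_2) : Prop :=
  open Omega /\ connected Omega.

(* A smooth map into the loop group of SL(2, R) is encoded by joint smoothness
   of (p, lambda) |-> Fh lambda p on Omega x (R \ {0}); values of Fh elsewhere
   are irrelevant. *)
Definition frame_with_coefs (Omega : set 'rV[R]_2)
    (Fh : R -> 'rV[R]_2 -> 'M[R]_2)
    (A1 A2 A3 B1 B2 B3 : 'rV[R]_2 -> R) : Prop :=
  [/\ smooth_on [set q : 'rV[R]_2 * R | Omega q.1 /\ q.2 != 0]
        (fun q => Fh q.2 q.1),
      forall l p, l != 0 -> Omega p -> \det (Fh l p) = 1,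
      forall l p, l != 0 -> Omega p ->
        invmx (Fh l p) *m dx (Fh l) p =
        (l * A1 p) *: xi1 + A2 p *: xi2 + A3 p *: e3 &
      forall l p, l != 0 -> Omega p ->
        invmx (Fh l p) *m dy (Fh l) p =
        B1 p *: xi1 + (l^-1 * B2 p) *: xi2 + B3 p *: e3].

Definition regular_admissible_frame (Omega : set 'rV[R]_2)
    (Fh : R -> 'rV[R]_2 -> 'M[R]_2) : Prop :=
  exists A1 A2 A3 B1 B2 B3 : 'rV[R]_2 -> R,
    frame_with_coefs Omega Fh A1 A2 A3 B1 B2 B3 /\
    (forall p, Omega p -> A1 p != 0 /\ B2 p != 0).

Definition frame_normal (Fh : R -> 'rV[R]_2 -> 'M[R]_2) : 'rV[R]_2 -> 'M[R]_2 :=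
  fun p => Ad (Fh 1 p) e3.

Definition g_plus (Fh : R -> 'rV[R]_2 -> 'M[R]_2) (theta : R) :
    'rV[R]_2 -> 'M[R]_2 :=
  fun p => Fh (expR (4 * theta)) p *m expmx (theta *: e3) *m invmx (Fh 1 p).

Definition g_minus (Fh : R -> 'rV[R]_2 -> 'M[R]_2) (theta : R) :
    'rV[R]_2 -> 'M[R]_2 :=
  fun p => e3 *m Fh (expR (4 * theta)) p *m e3 *m expmx (theta *: e3)
             *m invmx (Fh 1 p).

Definition K_plus (theta : R) : R := (sinh theta ^+ 2)^-1.
Definition K_minus (theta : R) : R := - (cosh theta ^+ 2)^-1.

End AntiDeSitter.

(* Main.v *)
Require Import Defs.
From HB Require Import structures.
From mathcomp Require Import all_boot all_order all_algebra.
From mathcomp Require Import all_classical all_reals all_analysis.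
From mathcomp Require Import ring lra.

(* Put u = exp theta, l = u^4, D = exp(theta e3) = diag(u^-1, u), and s = 1 for
   g_+, s = -1 for g_-. Both surfaces are g = G D F^-1, where G^-1 dG arises
   from F^-1 dF by multiplying the coefficients of xi1, xi2 in dx by s l, s and
   in dy by s, s l^-1 (conjugation by e3 changes the signs of xi1 and xi2). With
   c = s u - u^-1 and k = s u + u^-1, for the normal N = g nu,
     g_x = c G (u^2 A1 xi1 + A2 xi2) F^-1,
     g_y = - s c G (B1 xi1 + u^-2 B2 xi2) F^-1,
     N_x = k G (- u^2 A1 xi1 + A2 xi2) F^-1,
     N_y = s k G (- B1 xi1 + u^-2 B2 xi2) F^-1.
   Since L = - <g_x, N_x> and likewise for the other coefficients, L and the
   coefficient of dy^2 vanish, while, with W = A1 B2 - A2 B1,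
   det I = - (c^2 W / 2)^2 and det II = - (s c k W / 2)^2. Finally W <> 0
   wherever nu is an immersion, because (B2, - A2) is in the kernel of d nu
   if W = 0. Hence K + 1 = k^2 / c^2. *)

Set Implicit Arguments.
Unset Strict Implicit.
Unset Printing Implicit Defensive.

Import Order.TTheory GRing.Theory Num.Theory numFieldNormedType.Exports.

Local Open Scope classical_set_scope.
Local Open Scope ring_scope.


(** * Chain and product rules for linear and bilinear maps, in particular the matrix product *)

Section DerivativeRules.
Context {R : realType}.

Lemma cvg_sumr {T : Type} {I : Type} {F : set_system T} {FF : Filter F}
    {W : normedModType R} (r : seq I) (f : I -> T -> W) (l : I -> W) :
  (forall i, f i x @[x --> F] --> l i) ->
  \sum_(i <- r) f i x @[x --> F] --> \sum_(i <- r) l i.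
Proof.
move=> fl.
have ac : continuous (fun x : W * W => x.1 + x.2) by exact: add_continuous.
exact: (@cvg_big W I +%R 0 xpredT ac T F r f l FF (fun i _ => fl i)).
Qed.

Lemma derive_comp_linear {V W W' : normedModType R} (L : {linear W -> W'})
    (f : V -> W) p v : continuous L -> differentiable f p ->
  differentiable (L \o f) p /\ 'D_v (L \o f) p = L ('D_v f p).
Proof.
move=> Lc fp; have Ld : differentiable L (f p) by exact: linear_differentiable.
have Lfp : differentiable (L \o f) p by exact: differentiable_comp.
by split => //; rewrite !deriveE // diff_comp // diff_lin.
Qed.

Lemma derive_bilinear {V U W Z : normedModType R}
    (B : {bilinear U -> W -> Z}) (f : V -> U) (g : V -> W) p v :
  continuous (fun q => B q.1 q.2) ->
  differentiable f p -> differentiable g p ->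
  differentiable (fun q => B (f q) (g q)) p /\
  'D_v (fun q => B (f q) (g q)) p = B ('D_v f p) (g p) + B (f p) ('D_v g p).
Proof.
move=> Bc fp gp.
have -> : (fun q => B (f q) (g q)) =
  (fun q => B q.1 q.2) \o (fun q => (f q, g q)) by [].
have fgp : differentiable (fun q => (f q, g q)) p by exact: differentiable_pair.
have Bp := differentiable_bilin (f p, g p) Bc.
have Bfg : differentiable
   ((fun q => B q.1 q.2) \o (fun q => (f q, g q))) p.
  exact: differentiable_comp.
split => //; rewrite !deriveE // diff_comp //= diff_bilin //=.
by rewrite diff_pair //= addrC.
Qed.

(** Expanding in the elementary matrices writes [L] as a finite sum of coordinate functions times
    fixed vectors, each term of which is continuous. *)
Lemma matrix_linear_continuous m n (W : normedModType R)
    (L : {linear 'M[R]_(m, n) -> W}) : continuous L.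
Proof.
have -> : (L : _ -> _) =
    fun X => \sum_i \sum_j X i j *: L (delta_mx i j).
  apply/funext => X; rewrite {1}(matrix_sum_delta X) linear_sum.
  by apply: eq_bigr => i _; rewrite linear_sum; apply: eq_bigr => j _;
    rewrite linearZ.
move=> X; have FX := nbhs_filter X.
apply: (@cvg_sumr _ _ _ FX) => i; apply: (@cvg_sumr _ _ _ FX) => j.
by apply: cvgZr_tmp; exact: coord_continuous.
Qed.

Lemma mulmx_continuous m n p :
  continuous (fun q : 'M[R]_(m, n) * 'M[R]_(n, p) => q.1 *m q.2).
Proof.
have -> : (fun q : 'M[R]_(m, n) * 'M[R]_(n, p) => q.1 *m q.2) =
    fun q => \sum_i \sum_j (\sum_k q.1 i k * q.2 k j) *: delta_mx i j.
  apply/funext => q; rewrite {1}(matrix_sum_delta (q.1 *m q.2)).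
  by apply: eq_bigr => i _; apply: eq_bigr => j _; rewrite mxE.
move=> q; have Fq := nbhs_filter q.
apply: (@cvg_sumr _ _ _ Fq) => i; apply: (@cvg_sumr _ _ _ Fq) => j.
apply: cvgZr_tmp.
apply: (@cvg_sumr _ _ _ Fq) => k; apply: cvgM.
  apply: (@continuous_comp _ _ _ fst (fun M : 'M[R]_(m, n) => M i k)).
    exact: cvg_fst.
  exact: coord_continuous.
apply: (@continuous_comp _ _ _ snd (fun M : 'M[R]_(n, p) => M k j)).
  exact: cvg_snd.
exact: coord_continuous.
Qed.

Lemma derive_mulmx {V : normedModType R} m n k (f : V -> 'M[R]_(m, n))
    (g : V -> 'M[R]_(n, k)) p v : differentiable f p -> differentiable g p ->
  differentiable (fun q => f q *m g q) p /\
  'D_v (fun q => f q *m g q) p = 'D_v f p *m g p + f p *m 'D_v g p.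
Proof.
exact: (derive_bilinear (B := @mulmx R m n k) v (@mulmx_continuous _ _ _)).
Qed.

End DerivativeRules.

(** * Locality of differentiability, and stability of smoothness under algebraic operations and
    slicing *)

Section SmoothOn.
Context {R : realType}.

(** The first-order expansion of [f] at [p] depends only on the germ, so it is also an expansion of
    [g]; uniqueness of the differential then identifies ['d g p] with ['d f p]. *)
Lemma near_differentiable {V W : normedModType R} (f g : V -> W) p :
  (\near p, f p = g p) -> differentiable f p -> differentiable g p.
Proof.
move=> fg fp; have fgp : f p = g p by exact: nbhs_singleton fg.
have E : g \o shift p = cst (g p) + 'd f p +o_ 0 id.
  apply/eqaddoP => e e0.
  have /eqaddoP/(_ e e0) := diff_locally fp.
  have : \forall h \near (0 : V), f (h + p) = g (h + p).
    by move: fg; rewrite (near_shift 0) subr0.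
  apply: filterS2 => h /= fgh; rewrite !fctE /= -fgp.
  by rewrite fgh.
have dg := diff_unique (diff_continuous fp) E.
by apply/diff_locallyP; rewrite dg; split => //; exact: diff_continuous.
Qed.

Lemma open_near_eq {T : topologicalType} {S : Type} {U : set T} {f g : T -> S}
    p : open U -> (forall q, U q -> f q = g q) -> U p -> \near p, f p = g p.
Proof. by move=> Uo fg Up; exact: filterS fg (open_nbhs_nbhs (conj Uo Up)). Qed.

(** The functions in [C_on] are total, with arbitrary values off [U]. Since [U] is open, equality on
    [U] gives equality of germs at each of its points, hence equal derivatives on [U], and the
    induction continues with these. *)
Lemma C_on_eq {V W : normedModType R} k (U : set V) (f g : V -> W) :
  open U -> (forall p, U p -> f p = g p) -> C_on k U f -> C_on k U g.
Proof.
move=> Uo; elim: k f g => [|k IH] f g fg /=.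
  move=> fc p Up; have fcp : f x @[x --> p] --> f p by exact: fc.
  rewrite (fg p Up) in fcp.
  apply: cvg_trans fcp; apply: near_eq_cvg; exact: (open_near_eq Uo fg Up).
move=> [fd fD]; split=> [p Up|v].
  by apply: near_differentiable (fd p Up); exact: (open_near_eq Uo fg Up).
apply: (IH (fun p => 'D_v f p)) => // p Up; apply: near_eq_derive.
exact: (open_near_eq Uo fg Up).
Qed.

Lemma smooth_on_eq {V W : normedModType R} (U : set V) (f g : V -> W) :
  open U -> (forall p, U p -> f p = g p) -> smooth_on U f -> smooth_on U g.
Proof. by move=> Uo fg fs k; exact: C_on_eq fg (fs k). Qed.

Lemma smooth_on_subset {V W : normedModType R} (U U' : set V) (f : V -> W) :
  U `<=` U' -> smooth_on U' f -> smooth_on U f.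
Proof.
move=> UU' fs k; move: (fs k); elim: k f {fs} => [|k IH] f /=.
  by move=> fc p /UU' /fc.
by move=> [fd fD]; split=> [p /UU' /fd //|v]; exact: IH.
Qed.

Lemma smooth_on_derive {V W : normedModType R} (U : set V) (f : V -> W) v :
  smooth_on U f -> smooth_on U (fun p => 'D_v f p).
Proof. by move=> fs k; have [_] := fs k.+1; apply. Qed.

Lemma smooth_on_differentiable {V W : normedModType R} (U : set V)
    (f : V -> W) p : smooth_on U f -> U p -> differentiable f p.
Proof. by move=> fs; have [fd _] := fs 1%N; exact: fd. Qed.

Lemma C_onD {V W : normedModType R} k (U : set V) (f g : V -> W) : open U ->
  C_on k U f -> C_on k U g -> C_on k U (fun p => f p + g p).
Proof.
move=> Uo; elim: k f g => [|k IH] f g /=.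
  by move=> fc gc p Up; apply: cvgD; [exact: fc|exact: gc].
move=> [fd fD] [gd gD]; split=> [p Up|v].
  by apply: differentiableD; [exact: fd|exact: gd].
apply: (@C_on_eq _ _ _ _ (fun p => 'D_v f p + 'D_v g p)) => // [p Up|].
  rewrite -deriveD //; apply: diff_derivable; [exact: fd|exact: gd].
exact: IH.
Qed.

Lemma smooth_on_cst {V W : normedModType R} (U : set V) (a : W) :
  smooth_on U (fun _ => a).
Proof.
move=> k; elim: k a => [|k IH] a /=; first by move=> p _; exact: cvg_cst.
split=> [p _|v]; first exact: differentiable_cst.
have -> : 'D_v (fun _ : V => a) = fun=> 0.
  by apply/funext => p; rewrite derive_cst.
exact: IH.
Qed.

Lemma smooth_on_linear {V W W' : normedModType R} (L : {linear W -> W'})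
    (U : set V) (f : V -> W) : open U -> continuous L ->
  smooth_on U f -> smooth_on U (fun p => L (f p)).
Proof.
move=> Uo Lc fs k; elim: k f fs => [|k IH] f fs /=.
  move=> p Up; apply: differentiable_continuous.
  by have [] := derive_comp_linear 0 Lc (smooth_on_differentiable fs Up).
split=> [p Up|v].
  by have [] := derive_comp_linear 0 Lc (smooth_on_differentiable fs Up).
apply: (@C_on_eq _ _ _ _ (fun p => L ('D_v f p))) => // [p Up|].
  by have [] := derive_comp_linear v Lc (smooth_on_differentiable fs Up).
by apply: IH; exact: smooth_on_derive.
Qed.

(** By the Leibniz rule the derivative is a sum of two products of smooth maps, so the induction on
    the order runs over all [f] and [g] at once. *)
Lemma smooth_on_mulmx {V : normedModType R} m n k (U : set V)
    (f : V -> 'M[R]_(m, n)) (g : V -> 'M[R]_(n, k)) : open U ->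
  smooth_on U f -> smooth_on U g -> smooth_on U (fun p => f p *m g p).
Proof.
move=> Uo fs gs l; elim: l f g fs gs => [|l IH] f g fs gs /=.
  move=> p Up; apply: differentiable_continuous.
  by have [] := derive_mulmx 0 (smooth_on_differentiable fs Up)
                                     (smooth_on_differentiable gs Up).
split=> [p Up|v].
  by have [] := derive_mulmx 0 (smooth_on_differentiable fs Up)
                                     (smooth_on_differentiable gs Up).
apply: (@C_on_eq _ _ _ _
    (fun p => 'D_v f p *m g p + f p *m 'D_v g p)) => // [p Up|].
  by have [] := derive_mulmx v (smooth_on_differentiable fs Up)
                                     (smooth_on_differentiable gs Up).
by apply: C_onD => //; apply: IH => //; exact: smooth_on_derive.
Qed.

(** Extracts smoothness of the frame at a fixed spectral parameter from joint smoothness. The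
    derivative of a slice along [v] is the slice of the derivative along [(v, 0)], because the
    difference quotients are the same. *)
Lemma smooth_on_slice {V V' W : normedModType R} (U : set V) (l : V')
    (D : set (V * V')) (f : V * V' -> W) : (forall p, U p -> D (p, l)) ->
  smooth_on D f -> smooth_on U (fun p => f (p, l)).
Proof.
move=> UD fs k; move: (fs k); elim: k f {fs} => [|k IH] f /=.
  move=> fc p Up.
  apply: (@continuous_comp _ _ _ (fun p => (p, l)) f);
    last exact: fc _ (UD _ Up).
  by apply: cvg_pair => //=; exact: cvg_cst.
move=> [fd fD]; split=> [p Up|v].
  apply: (@differentiable_comp _ _ _ _ (fun p => (p, l)) f).
    exact: differentiable_pair.
  by apply: fd; exact: UD.
have -> : (fun p => 'D_v (fun p => f (p, l)) p) =
    (fun p => 'D_(v, 0) f (p, l)).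
  apply/funext => p; rewrite /derive.
  f_equal; f_equal; apply/funext => h /=.
  rewrite -[h *: (v, 0) + (p, l)]/((h *: v + p, h *: 0 + l)) scaler0.
  by rewrite add0r.
exact: (IH ('D_(v, 0) f) (fD (v, 0))).
Qed.
End SmoothOn.

(** * Algebra of 2x2 matrices: entries, adjugate, the inner product, and Lorentzian forms *)

Section TwoByTwo.
Context {R : realType}.
Implicit Types (X Y F G : 'M[R]_2) (a b c d : R).

Lemma mx2P X Y : X 0 0 = Y 0 0 -> X 0 1 = Y 0 1 -> X 1 0 = Y 1 0 ->
  X 1 1 = Y 1 1 -> X = Y.
Proof.
move=> e00 e01 e10 e11; apply/matrixP => i j.
have ord2 (k : 'I_2) : k = 0 \/ k = 1.
  by case: k => -[|[|//]] k2; [left|right]; apply/val_inj.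
by case: (ord2 i) => ->; case: (ord2 j) => ->.
Qed.

Lemma mx2_00 a b c d : mx2 a b c d 0 0 = a. Proof. by rewrite mxE. Qed.
Lemma mx2_01 a b c d : mx2 a b c d 0 1 = b. Proof. by rewrite mxE. Qed.
Lemma mx2_10 a b c d : mx2 a b c d 1 0 = c. Proof. by rewrite mxE. Qed.
Lemma mx2_11 a b c d : mx2 a b c d 1 1 = d. Proof. by rewrite mxE. Qed.
Definition mx2E := (mx2_00, mx2_01, mx2_10, mx2_11).

Lemma mulmx2E X Y i j : (X *m Y) i j = X i 0 * Y 0 j + X i 1 * Y 1 j.
Proof.
rewrite mxE !big_ord_recl big_ord0 addr0.
by congr (_ + X i _ * Y _ j); apply/val_inj.
Qed.

Lemma mulmx_mx2 a b c d a' b' c' d' : mx2 a b c d *m mx2 a' b' c' d' =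
  mx2 (a * a' + b * c') (a * b' + b * d') (c * a' + d * c') (c * b' + d * d').
Proof. by apply: mx2P; rewrite mulmx2E !mx2E. Qed.

Lemma subr_mx2 a b c d a' b' c' d' : mx2 a b c d - mx2 a' b' c' d' =
  mx2 (a - a') (b - b') (c - c') (d - d').
Proof. by apply: mx2P; rewrite !mxE. Qed.

Lemma det2E X : \det X = X 0 0 * X 1 1 - X 0 1 * X 1 0.
Proof.
have l01 : lift 0 0 = 1 :> 'I_2 by exact: val_inj.
have l10 : lift 1 0 = 0 :> 'I_2 by exact: val_inj.
rewrite (expand_det_row X 0) !big_ord_recl big_ord0 addr0 /cofactor !det_mx11.
by rewrite !mxE !l01 !l10 /= expr0 expr1 mul1r mulN1r mulrN.
Qed.

Lemma tr2E X : \tr X = X 0 0 + X 1 1.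
Proof.
rewrite /mxtrace !big_ord_recl big_ord0 addr0.
by congr (_ + X _ _); apply/val_inj.
Qed.

(* The adjugate is linear and inverts SL(2), so inverses of frames can be
   differentiated as linear expressions. *)
Definition adj2 X : 'M[R]_2 := (\tr X)%:M - X.

Fact adj2_is_linear : linear adj2.
Proof.
move=> a X Y; rewrite /adj2 linearP /= raddfD /= -scale_scalar_mx.
by rewrite scalerBr opprD addrACA.
Qed.
HB.instance Definition _ :=
  GRing.isLinear.Build R 'M[R]_2 'M[R]_2 _ adj2 adj2_is_linear.

Lemma adj2E X : adj2 X = mx2 (X 1 1) (- X 0 1) (- X 1 0) (X 0 0).
Proof.
by apply: mx2P; rewrite mx2E /adj2 tr2E !mxE /= ?mulr1n ?mulr0n; ring.
Qed.

Lemma mulmx_adj2 X : X *m adj2 X = (\det X)%:M.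
Proof.
rewrite adj2E; apply: mx2P; rewrite mulmx2E !mx2E det2E.
all: by rewrite !mxE /= ?mulr1n ?mulr0n; ring.
Qed.

Lemma det_adj2 X : \det (adj2 X) = \det X.
Proof. by rewrite !det2E adj2E !mx2E; ring. Qed.

Lemma adj2M X Y : adj2 (X *m Y) = adj2 Y *m adj2 X.
Proof.
by rewrite !adj2E; apply: mx2P; rewrite ?mx2E !mulmx2E !mx2E; ring.
Qed.

Lemma adj2_trace0 X : \tr X = 0 -> adj2 X = - X.
Proof. by rewrite /adj2 => ->; rewrite raddf0 sub0r. Qed.

Lemma invmx_adj2 X : \det X = 1 -> invmx X = adj2 X.
Proof.
move=> X1; have Xu : X \in unitmx by rewrite unitmxE X1 unitr1.
by rewrite -[RHS](mulKmx Xu) mulmx_adj2 X1 mulmx1.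
Qed.

Lemma ipE X Y :
  ip X Y = - 2^-1 *
    (X 0 0 * Y 1 1 + X 1 1 * Y 0 0 - X 0 1 * Y 1 0 - X 1 0 * Y 0 1).
Proof.
by rewrite /ip -/(adj2 Y) adj2E tr2E !mulmx2E !mx2E; ring.
Qed.

(** [ip] is the polarization of minus the determinant, which is multiplicative. For factors in SL(2)
    this is an isometry, so inner products along a surface reduce to those of the middle factors. *)
Lemma ip_mulmx G F X Y :
  ip (G *m X *m F) (G *m Y *m F) = \det G * \det F * ip X Y.
Proof. by rewrite !ipE !mulmx2E !det2E; ring. Qed.

Lemma ipDl X Y F : ip (X + Y) F = ip X F + ip Y F.
Proof. by rewrite !ipE !mxE; ring. Qed.

Lemma ipZl a X Y : ip (a *: X) Y = a * ip X Y.
Proof. by rewrite !ipE !mxE; ring. Qed.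

Lemma ip0l Y : ip 0 Y = 0.
Proof. by rewrite ipE !mxE; ring. Qed.

Lemma ip_det X : ip X X = - \det X.
Proof. by rewrite ipE det2E; field. Qed.

(** A symmetric form in two variables with negative determinant has signature (1, 1); an orthonormal
    basis is written down explicitly, according to the sign of the first diagonal entry. *)
Lemma lorentzian_det (B : 'M[R]_2) :
  B 0 1 = B 1 0 -> \det B < 0 -> lorentzian B.
Proof.
rewrite det2E => sym; rewrite -sym.
set a := B 0 0; set b := B 0 1; set d := B 1 1 => dlt.
suff [P PB] : exists P : 'M[R]_2, P *m B *m P^T = mx2 1 0 0 (-1).
  (* Invertibility is automatic: a singular [P] would make the determinant of the product 0, whereas
     it is -1. *)
  exists P => //; rewrite unitmxE unitfE; apply/eqP => P0.
  have := congr1 determinant PB; rewrite !det_mulmx P0 !mul0r det2E !mx2E.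
  by apply/eqP; rewrite eq_sym; lra.
(* The rows [(x, y)] and [(z, t)] of [P] must be orthogonal for [B], of square norms 1 and -1. *)
have PBE x y z t : a * x ^+ 2 + 2 * b * x * y + d * y ^+ 2 = 1 ->
    a * x * z + b * (x * t + y * z) + d * y * t = 0 ->
    a * z ^+ 2 + 2 * b * z * t + d * t ^+ 2 = -1 ->
    exists P : 'M[R]_2, P *m B *m P^T = mx2 1 0 0 (-1).
  move=> e1 e2 e3; exists (mx2 x y z t).
  apply: mx2P; rewrite !mulmx2E ![_^T _ _]mxE !mx2E -?sym -/a -/b -/d.
  - by rewrite -e1; ring.
  - by rewrite -[RHS]e2; ring.
  - by rewrite -[RHS]e2; ring.
  - by rewrite -e3; ring.
have D0 : 0 < b * b - a * d by lra.
have sq (r : R) : 0 < r -> exists2 q, q != 0 & r = q ^+ 2.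
  move=> r0; exists (Num.sqrt r); first by rewrite gt_eqF // sqrtr_gt0.
  by rewrite sqr_sqrtr // ltW.
have [a0|a0|a0] := ltgtP a 0.
(* Gram-Schmidt from the first basis vector: [(- b, a)] is orthogonal to [(1, 0)] and has square
   norm [a * (a * d - b * b)]. For [a < 0] the vector [(1, 0)] gives the negative direction, for
   [a > 0] the positive one. *)
- have [q q0 qE] : exists2 q, q != 0 & - a = q ^+ 2 by apply: sq; lra.
  have [r r0 rE] := sq _ D0.
  have aE : a = - q ^+ 2 by rewrite -qE opprK.
  have dE : d = (b ^+ 2 - r ^+ 2) / a by rewrite -rE; field; rewrite lt_eqF.
  apply: (PBE (- b / (q * r)) (a / (q * r)) q^-1 0);
    by rewrite dE aE; field; rewrite ?q0 ?r0 // oppr_eq0 expf_eq0 (negPf q0).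
- have [q q0 qE] := sq _ a0.
  have [r r0 rE] := sq _ D0.
  have dE : d = (b ^+ 2 - r ^+ 2) / a by rewrite -rE; field; rewrite gt_eqF.
  apply: (PBE q^-1 0 (- b / (q * r)) (a / (q * r)));
    by rewrite dE qE; field; rewrite ?q0 ?r0.
(* Here [(1, 0)] is null and cannot be normalized; on vectors [(x, 1)] the form is [2 * b * x + d],
   which is solved for the values 1 and -1. *)
- have b0 : b != 0 by apply: contraTneq D0 => ->; rewrite a0; lra.
  apply: (PBE ((1 - d) / (2 * b)) 1 ((-1 - d) / (2 * b)) 1);
    by rewrite a0; field.
Qed.

End TwoByTwo.

(** * The matrix exponential of a multiple of [e3] *)

Section Exponential.
Context {R : realType}.

(** Powers of a diagonal matrix are diagonal, so the partial sums split into two scalar exponential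
    series multiplying fixed matrices, and the limit is taken in each. *)
Lemma expmx_e3 (t : R) : expmx (t *: e3 R) = mx2 (expR t)^-1 0 0 (expR t).
Proof.
have -> : t *: e3 R = mx2 (- t) 0 0 t by apply: mx2P; rewrite !mxE /=; ring.
have pow k : mx2 (- t) 0 0 t ^+ k = mx2 ((- t) ^+ k) 0 0 (t ^+ k).
  elim: k => [|k IH]; first by apply: mx2P; rewrite mx2E !expr0 mxE.
  rewrite exprS IH -[_ * _]/(_ *m _) mulmx_mx2 !exprS.
  by congr mx2; ring.
have sumE n : \sum_(0 <= k < n) (k`!%:R)^-1 *: mx2 (- t) 0 0 t ^+ k =
    series (exp_coeff (- t)) n *: mx2 1 0 0 0
    + series (exp_coeff t) n *: mx2 0 0 0 1.
  rewrite /series /= !scaler_suml -big_split /=; apply: eq_bigr => k _.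
  rewrite pow; apply: mx2P;
    by rewrite !mxE /= ?mulr0 ?mulr1 ?addr0 ?add0r // mulrC.
rewrite -expRN /expmx; apply/cvg_lim; first exact: norm_hausdorff.
have -> : mx2 (expR (- t)) 0 0 (expR t) =
    expR (- t) *: mx2 1 0 0 0 + expR t *: mx2 0 0 0 1.
  by apply: mx2P; rewrite !mxE /=; ring.
under eq_fun do rewrite sumE.
by apply: cvgD; apply: cvgZr_tmp; exact: is_cvg_series_exp_coeff.
Qed.

End Exponential.

(** * Derivatives of matrix-valued maps built from frames *)

Section MatrixMaps.
Context {R : realType} {V : normedModType R}.
Implicit Types (f g F G : V -> 'M[R]_2) (p v : V).

Lemma derive_cst_mulmx f (C : 'M[R]_2) p v : differentiable f p ->
  differentiable (fun q => f q *m C) p /\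
  'D_v (fun q => f q *m C) p = 'D_v f p *m C.
Proof.
move=> fp; have [fd ->] := derive_mulmx v fp (differentiable_cst C p).
by split => //; rewrite derive_cst mulmx0 addr0.
Qed.

Lemma derive_adj2 f p v : differentiable f p ->
  differentiable (fun q => adj2 (f q)) p /\
  'D_v (fun q => adj2 (f q)) p = adj2 ('D_v f p).
Proof.
exact: (derive_comp_linear (L := @adj2 R) v
  (@matrix_linear_continuous _ _ _ _ _)).
Qed.

(** For trace-free [a] one has [adj2 a = - a], so [adj2 F] differentiates like the inverse of [F];
    this produces the difference [b C - C a]. *)
Lemma derive_frame_product F G (a b C : 'M[R]_2) p v :
  differentiable F p -> differentiable G p -> \tr a = 0 ->
  'D_v F p = F p *m a -> 'D_v G p = G p *m b ->
  'D_v (fun q => G q *m C *m adj2 (F q)) p =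
  G p *m (b *m C - C *m a) *m adj2 (F p).
Proof.
move=> Fp Gp a0 DF DG.
have [GCp DGC] := derive_cst_mulmx C v Gp; have [aFp DaF] := derive_adj2 v Fp.
have [_ ->] := derive_mulmx v GCp aFp; rewrite DGC DaF DF DG adj2M.
rewrite (adj2_trace0 a0) (mulmxBr (G p)) (mulmxBl _ _ (adj2 (F p))).
by rewrite mulNmx mulmxN !mulmxA.
Qed.

(** Applied to a tangent field and the normal, this trades a second derivative of the surface for a
    first derivative of the normal. *)
Lemma derive_ip_eq0 f g p v : differentiable f p -> differentiable g p ->
  (\near p, ip (f p) (g p) = 0) ->
  ip ('D_v f p) (g p) = - ip (f p) ('D_v g p).
Proof.
move=> fp gp fg0; have [agp Dag] := derive_adj2 v gp.
have [hp Dh] := derive_mulmx v fp agp; have [ahp Dah] := derive_adj2 v hp.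
set h := fun q => _ in hp Dh ahp Dah.
have trip X Y : \tr (X *m adj2 Y) = -2 * ip X Y :> R.
  by rewrite /ip -/(adj2 Y); field.
(* The trace form is expressed by [X + adj2 X = (\tr X)%:M], which keeps all
   derivatives matrix-valued. *)
have : 'D_v h p + adj2 ('D_v h p) = 0.
  rewrite -Dah -deriveD; [|exact: diff_derivable..].
  rewrite -[RHS](derive_cst (0 : 'M[R]_2) p v); apply: near_eq_derive.
  apply: filterS fg0 => q fg0; rewrite fctE /adj2 addrC subrK trip fg0.
  by rewrite mulr0 raddf0.
rewrite /adj2 addrC subrK Dh Dag => /(congr1 (fun M : 'M[R]_2 => M 0 0)).
rewrite raddfD /= !trip !mxE /= mulr1n; lra.
Qed.

End MatrixMaps.

(** * Differentials in coordinates and the Gram criterion for immersions *)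

Section ParametrizedSurfaces.
Context {R : realType}.
Implicit Types (f g F G N : 'rV[R]_2 -> 'M[R]_2) (p : 'rV[R]_2).

Lemma diff_dx_dy f p v : differentiable f p ->
  'd f p v = v 0 0 *: dx f p + v 0 1 *: dy f p.
Proof.
move=> fp; rewrite /dx /dy !deriveE // {1}[v]row_sum_delta linear_sum.
rewrite !big_ord_recl big_ord0 addr0 /= !linearZ /=.
by congr (_ + v _ _ *: 'd f p (delta_mx _ _)); apply/val_inj.
Qed.

Lemma rV2_eq0 (v : 'rV[R]_2) : v 0 0 = 0 -> v 0 1 = 0 -> v = 0.
Proof.
move=> v0 v1; apply/rowP => -[[|[|//]] k2]; rewrite [RHS]mxE.
  by rewrite -v0; congr (v _ _); apply/val_inj.
by rewrite -v1; congr (v _ _); apply/val_inj.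
Qed.

(** Pairing a relation ['d f p z = 0] with [dx f p] and [dy f p] gives a homogeneous linear system
    for the coordinates of [z] whose matrix is the first form; Cramer's rule forces [z = 0]. *)
Lemma immersion_at_first_form f p : differentiable f p ->
  \det (first_form f p) != 0 -> immersion_at f p.
Proof.
have solve2 (a b c d x y : R) : a * d - b * c != 0 ->
    x * a + y * c = 0 -> x * b + y * d = 0 -> x = 0 /\ y = 0.
  move=> det0 e1 e2; split; apply: (mulIf det0); rewrite mul0r.
    transitivity (d * (x * a + y * c) - c * (x * b + y * d)); first by ring.
    by rewrite e1 e2 !mulr0 subr0.
  transitivity (a * (x * b + y * d) - b * (x * a + y * c)); first by ring.
  by rewrite e1 e2 !mulr0 subr0.
move=> fp; rewrite det2E /first_form !mx2E => det0; split => // v w vw.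
apply/eqP; rewrite -subr_eq0; apply/eqP; set z := v - w.
have : 'd f p z = 0 by rewrite /z linearB /= vw subrr.
rewrite diff_dx_dy // => z0.
have key X : z 0 0 * ip (dx f p) X + z 0 1 * ip (dy f p) X = 0.
  by rewrite -!ipZl -ipDl z0 ip0l.
have [z00 z01] := solve2 _ _ _ _ _ _ det0 (key (dx f p)) (key (dy f p)).
exact: rV2_eq0.
Qed.

End ParametrizedSurfaces.

(** * Smoothness and derivatives of products of the form G C F^-1 *)

Section FrameProducts.
Context {R : realType} {V : normedModType R} {Omega : set V}.
Context {F G : V -> 'M[R]_2}.
Hypothesis Omega_open : open Omega.
Hypothesis F_smooth : smooth_on Omega F.
Hypothesis G_smooth : smooth_on Omega G.
Hypothesis det_F : forall p, Omega p -> \det (F p) = 1.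

(** The determinant of [F] is known to be 1 only on [Omega]; agreement near [p] is enough to
    transfer derivatives from the adjugate to the inverse. *)
Lemma near_invmx_adj2 (C : 'M[R]_2) p : Omega p ->
  \near p, G p *m C *m adj2 (F p) = G p *m C *m invmx (F p).
Proof.
move=> Op; apply: filterS (open_nbhs_nbhs (conj Omega_open Op)) => q Oq.
by rewrite invmx_adj2 // det_F.
Qed.

Lemma smooth_frame_product (C : 'M[R]_2) :
  smooth_on Omega (fun p => G p *m C *m invmx (F p)).
Proof.
apply: (@smooth_on_eq _ _ _ _ (fun p => G p *m C *m adj2 (F p))) => //.
  by move=> p Op; rewrite invmx_adj2 // det_F.
apply: smooth_on_mulmx => //.
  by apply: smooth_on_mulmx => //; exact: smooth_on_cst.
exact: (smooth_on_linear (L := @adj2 R) Omega_open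
  (@matrix_linear_continuous _ _ _ _ _) F_smooth).
Qed.

Lemma derive_frame_product_inv (a b C : 'M[R]_2) p v : Omega p -> \tr a = 0 ->
  'D_v F p = F p *m a -> 'D_v G p = G p *m b ->
  'D_v (fun q => G q *m C *m invmx (F q)) p =
  G p *m (b *m C - C *m a) *m adj2 (F p).
Proof.
move=> Op a0 DF DG; rewrite -(near_eq_derive v (near_invmx_adj2 C Op)).
apply: derive_frame_product => //.
  exact: smooth_on_differentiable F_smooth Op.
exact: smooth_on_differentiable G_smooth Op.
Qed.

End FrameProducts.

(** * Common treatment of both surfaces, with sign [s] and u = exp theta *)

Section ParallelSurface.
Context {R : realType} {Omega : set 'rV[R]_2} {F G : 'rV[R]_2 -> 'M[R]_2}.
Context {A1 A2 A3 B1 B2 B3 : 'rV[R]_2 -> R} {s u : R}.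
Hypothesis Omega_open : open Omega.
Hypothesis F_smooth : smooth_on Omega F.
Hypothesis G_smooth : smooth_on Omega G.
Hypothesis det_F : forall p, Omega p -> \det (F p) = 1.
Hypothesis det_G : forall p, Omega p -> \det (G p) = 1.
Hypothesis dxF : forall p, Omega p ->
  dx F p = F p *m mx2 (- A3 p) (A2 p) (A1 p) (A3 p).
Hypothesis dyF : forall p, Omega p ->
  dy F p = F p *m mx2 (- B3 p) (B2 p) (B1 p) (B3 p).
Hypothesis dxG : forall p, Omega p ->
  dx G p = G p *m mx2 (- A3 p) (s * A2 p) (s * u ^+ 4 * A1 p) (A3 p).
Hypothesis dyG : forall p, Omega p ->
  dy G p = G p *m mx2 (- B3 p) (s * (u ^+ 4)^-1 * B2 p) (s * B1 p) (B3 p).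
Hypothesis B2_neq0 : forall p, Omega p -> B2 p != 0.
Hypothesis s_sqr : s * s = 1.
Hypothesis u_neq0 : u != 0.

Let c := s * u - u^-1.
Let k := s * u + u^-1.
Hypothesis c_neq0 : c != 0.
Hypothesis k_neq0 : k != 0.

Let D : 'M[R]_2 := mx2 u^-1 0 0 u.
Let g p := G p *m D *m invmx (F p).
(** This is g nu with the inner F^-1 F cancelled. In this shape [g], [N] and [nu] are all frame
    products and share one derivative formula. *)
Let N p := G p *m (D *m e3 R) *m invmx (F p).
Let nu p := Ad (F p) (e3 R).
Let W p := A1 p * B2 p - A2 p * B1 p.

Let traceless (a b d : R) : \tr (mx2 (- a) b d a) = 0.
Proof. by rewrite tr2E !mx2E addNr. Qed.

Let dx_g p : Omega p ->
  dx g p = G p *m mx2 0 (c * A2 p) (c * u ^+ 2 * A1 p) 0 *m adj2 (F p).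
Proof.
move=> Op; rewrite /dx (derive_frame_product_inv Omega_open F_smooth G_smooth
  det_F D Op (traceless _ _ _) (dxF Op) (dxG Op)).
congr (_ *m _ *m _).
by rewrite /D /e3 !mulmx_mx2 subr_mx2 /c; congr mx2; field.
Qed.

Let dy_g p : Omega p ->
  dy g p = G p *m mx2 0 (- s * c * (u ^+ 2)^-1 * B2 p) (- s * c * B1 p) 0
             *m adj2 (F p).
Proof.
move=> Op; rewrite /dy (derive_frame_product_inv Omega_open F_smooth G_smooth
  det_F D Op (traceless _ _ _) (dyF Op) (dyG Op)).
congr (_ *m _ *m _).
(* The relation s^2 = 1 is spent here; the entries then agree as rational functions of [s] and
   [u]. *)
have -> : - s * c = s * u^-1 - u.
  by rewrite /c mulrBr mulrA mulNr s_sqr !mulNr mul1r opprK addrC.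
by rewrite /D /e3 !mulmx_mx2 subr_mx2; congr mx2; field.
Qed.

Let dx_N p : Omega p ->
  dx N p = G p *m mx2 0 (k * A2 p) (- k * u ^+ 2 * A1 p) 0 *m adj2 (F p).
Proof.
move=> Op; rewrite /dx (derive_frame_product_inv Omega_open F_smooth G_smooth
  det_F (D *m e3 R) Op (traceless _ _ _) (dxF Op) (dxG Op)).
congr (_ *m _ *m _).
by rewrite /D /e3 !mulmx_mx2 subr_mx2 /k; congr mx2; field.
Qed.

Let dy_N p : Omega p ->
  dy N p = G p *m mx2 0 (s * k * (u ^+ 2)^-1 * B2 p) (- (s * k) * B1 p) 0
             *m adj2 (F p).
Proof.
move=> Op; rewrite /dy (derive_frame_product_inv Omega_open F_smooth G_smooth
  det_F (D *m e3 R) Op (traceless _ _ _) (dyF Op) (dyG Op)).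
congr (_ *m _ *m _).
have -> : s * k = u + s * u^-1 by rewrite /k mulrDr mulrA s_sqr mul1r.
by rewrite /D /e3 !mulmx_mx2 subr_mx2; congr mx2; field.
Qed.

Let ip_frame p X Y : Omega p ->
  ip (G p *m X *m adj2 (F p)) (G p *m Y *m adj2 (F p)) = ip X Y.
Proof. by move=> Op; rewrite ip_mulmx det_adj2 det_F // det_G // !mul1r. Qed.

Let ip_offdiag (a b d e : R) :
  ip (mx2 0 a b 0) (mx2 0 d e 0) = (a * e + b * d) / 2.
Proof. by rewrite ipE !mx2E; field. Qed.

Let ip_diag_offdiag (a b d e : R) : ip (mx2 a 0 0 b) (mx2 0 d e 0) = 0.
Proof. by rewrite ipE !mx2E; ring. Qed.

Let g_adj2 p : Omega p -> g p = G p *m D *m adj2 (F p).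
Proof. by move=> Op; rewrite /g invmx_adj2 // det_F. Qed.

Let N_adj2 p : Omega p -> N p = G p *m mx2 (- u^-1) 0 0 u *m adj2 (F p).
Proof.
move=> Op; rewrite /N invmx_adj2 ?det_F // /D /e3 mulmx_mx2.
by congr (_ *m mx2 _ _ _ _ *m _); ring.
Qed.

Let W_neq0 (p : 'rV[R]_2) : Omega p -> immersion_at nu p -> W p != 0.
Proof.
move=> Op [nup inj]; apply/eqP => W0.
have dxnu : dx nu p = F p *m mx2 0 (2 * A2 p) (- 2 * A1 p) 0 *m adj2 (F p).
  rewrite /dx (derive_frame_product_inv Omega_open F_smooth F_smooth
    det_F (e3 R) Op (traceless _ _ _) (dxF Op) (dxF Op)).
  congr (_ *m _ *m _); rewrite /e3 !mulmx_mx2 subr_mx2; congr mx2; ring.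
have dynu : dy nu p = F p *m mx2 0 (2 * B2 p) (- 2 * B1 p) 0 *m adj2 (F p).
  rewrite /dy (derive_frame_product_inv Omega_open F_smooth F_smooth
    det_F (e3 R) Op (traceless _ _ _) (dyF Op) (dyF Op)).
  congr (_ *m _ *m _); rewrite /e3 !mulmx_mx2 subr_mx2; congr mx2; ring.
(* Along [v] the xi2 components of d nu cancel and the xi1 component is -2 W; regularity of the
   frame makes [v] non-zero. *)
pose v : 'rV[R]_2 := B2 p *: delta_mx 0 0 - A2 p *: delta_mx 0 1.
have v0 : v = 0.
  have lin (X Y Z : 'M[R]_2) a b : a *: (F p *m X *m Z) + b *: (F p *m Y *m Z) =
      F p *m (a *: X + b *: Y) *m Z.
    by rewrite mulmxDr mulmxDl -!scalemxAr -!scalemxAl.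
  apply: inj; rewrite linear0 diff_dx_dy // dxnu dynu lin.
  rewrite (_ : _ + _ = 0) ?mulmx0 ?mul0mx //.
  by move: W0; rewrite /W => W0; apply: mx2P; rewrite !mxE /=; lra.
have := B2_neq0 Op; move/eqP; apply.
have := congr1 (fun M : 'rV[R]_2 => M 0 0) v0.
by rewrite !mxE /= mulr1 mulr0 subr0.
Qed.

(** With X = A1 B2 and Y = A2 B1, the determinant is c^4 (X Y - (X + Y)^2 / 4), which is minus the
    square of c^2 (X - Y) / 2. *)
Let det_first_form p : Omega p ->
  \det (first_form g p) = - (c ^+ 2 * W p / 2) ^+ 2.
Proof.
move=> Op; rewrite /first_form dx_g // dy_g // !ip_frame // !ip_offdiag.
rewrite det2E !mx2E.
have -> : (c * A2 p * (- s * c * B1 p) +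
   c * u ^+ 2 * A1 p * (- s * c * (u ^+ 2)^-1 * B2 p)) / 2 =
   - s * (c ^+ 2 * (A2 p * B1 p + A1 p * B2 p) / 2) by field.
have -> : (- s * c * (u ^+ 2)^-1 * B2 p * (c * u ^+ 2 * A1 p) +
  - s * c * B1 p * (c * A2 p)) / 2 =
   - s * (c ^+ 2 * (A2 p * B1 p + A1 p * B2 p) / 2) by field.
(* Both off-diagonal entries equal [- s * T], so the sign enters only through its square. *)
set T := _ * _ / 2; have -> : - s * T * (- s * T) = s * s * (T * T) by ring.
rewrite s_sqr {}/T.
have -> : (- s * c * (u ^+ 2)^-1 * B2 p * (- s * c * B1 p) +
  - s * c * B1 p * (- s * c * (u ^+ 2)^-1 * B2 p)) / 2 =
  (s * s) * (c ^+ 2 * (u ^+ 2)^-1 * B1 p * B2 p) by field.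
by rewrite s_sqr /W; field.
Qed.

Let smooth_g : smooth_on Omega g.
Proof. exact: smooth_frame_product. Qed.

Let smooth_N : smooth_on Omega N.
Proof. exact: smooth_frame_product. Qed.

Let ip_N_dx_g p : Omega p -> ip (dx g p) (N p) = 0.
Proof.
move=> Op; rewrite dx_g // N_adj2 // ip_frame //.
by rewrite ipE !mx2E; ring.
Qed.

Let ip_N_dy_g p : Omega p -> ip (dy g p) (N p) = 0.
Proof.
move=> Op; rewrite dy_g // N_adj2 // ip_frame //.
by rewrite ipE !mx2E; ring.
Qed.

(** Up to scalar factors, passing from a derivative of [g] to the same derivative of [N] only flips
    the sign of the xi1 component. Since [ip] pairs xi1 with xi2, the two contributions to each
    diagonal coefficient cancel; in the mixed one they combine to a multiple of W. *)
Let second_form_g p : Omega p ->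
  second_form g N p = mx2 0 (- s * c * k * W p / 2) (- s * c * k * W p / 2) 0.
Proof.
move=> Op.
have dxgp :=
  smooth_on_differentiable (smooth_on_derive (delta_mx 0 0) smooth_g) Op.
have dygp :=
  smooth_on_differentiable (smooth_on_derive (delta_mx 0 1) smooth_g) Op.
have Np := smooth_on_differentiable smooth_N Op.
have near_p P : (forall q, Omega q -> P q) -> \near p, P p.
  by move=> OP; exact: filterS OP (open_nbhs_nbhs (conj Omega_open Op)).
have L0 : coefL g N p = 0.
  rewrite /coefL (derive_ip_eq0 (delta_mx 0 0) dxgp Np (near_p _ ip_N_dx_g)).
  rewrite -/(dx g p) -/(dx N p) dx_g // dx_N // ip_frame // ip_offdiag.
  by ring.
have N0 : Defs.coefN g N p = 0.
  rewrite /Defs.coefN (derive_ip_eq0 (delta_mx 0 1) dygp Np (near_p _ ip_N_dy_g)).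
  rewrite -/(dy g p) -/(dy N p) dy_g // dy_N // ip_frame // ip_offdiag.
  by ring.
have MW : Defs.coefM g N p = - s * c * k * W p / 2.
  rewrite /Defs.coefM (derive_ip_eq0 (delta_mx 0 1) dxgp Np (near_p _ ip_N_dx_g)).
  rewrite -/(dx g p) -/(dy N p) dx_g // dy_N // ip_frame // ip_offdiag /W.
  by field.
by rewrite /second_form L0 N0 MW.
Qed.

Lemma parallel_surface_cgc :
  cgc_surface (immersed_part Omega nu) g nu (k ^+ 2 / c ^+ 2 - 1).
Proof.
(* Smoothness is established on the open set [Omega] and then restricted to the part where [nu] is
   an immersion. *)
have sub : immersed_part Omega nu `<=` Omega by move=> p [].
have s0 : s != 0.
  by apply: contra_eq_neq s_sqr => ->; rewrite mul0r eq_sym oner_neq0.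
have det_e3 : \det (e3 R) = -1 by rewrite det2E !mx2E; ring.
have det_D : \det D = 1 by rewrite det2E !mx2E; field.
(* This one inequality yields both the immersion property and the Lorentzian signature. *)
have det_I p : immersed_part Omega nu p -> \det (first_form g p) < 0.
  move=> [Op imm]; rewrite det_first_form // oppr_lt0 exprn_even_gt0 //=.
  by rewrite !mulf_neq0 ?expf_neq0 ?invr_neq0 ?W_neq0 // pnatr_eq0.
split; first split.
- exact: smooth_on_subset sub smooth_g.
- move=> p /sub Op; rewrite /H31 /= ip_det g_adj2 // !det_mulmx det_adj2.
  by rewrite det_F // det_G // det_D !mul1r.
- move=> p Up; apply: immersion_at_first_form; last by rewrite lt_eqF ?det_I.
  exact: smooth_on_differentiable smooth_g (sub _ Up).
- move=> p Up; apply: lorentzian_det (det_I p Up).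
  have Op := sub _ Up.
  by rewrite /first_form dx_g // dy_g // !ip_frame // !ip_offdiag !mx2E; ring.
exists N; split.
- split; first exact: smooth_on_subset sub smooth_N.
  move=> p /sub Op; split.
  + rewrite ip_det /N !det_mulmx det_D det_e3 det_inv det_F // det_G //.
    by rewrite invr1; ring.
  + by rewrite N_adj2 // g_adj2 // ip_frame // ipE !mx2E; field.
  + by rewrite N_adj2 // dx_g // ip_frame // ip_diag_offdiag.
  + by rewrite N_adj2 // dy_g // ip_frame // ip_diag_offdiag.
- move=> p /sub Op.
  have Fu : F p \in unitmx by rewrite unitmxE det_F // unitr1.
  have gu : g p \in unitmx.
    rewrite unitmxE /g !det_mulmx det_inv det_F // det_G // det_D.
    by rewrite !mul1r invr1 unitr1.
  split.
    have -> : N p = g p *m nu p by rewrite /N /g /nu /Ad !mulmxA mulmxKV.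
    by rewrite mulKmx.
  rewrite /S21 /= ip_det /nu /Ad mxtrace_mulC mulmxA mulVmx // mul1mx.
  rewrite !det_mulmx det_inv det_F // det_e3 tr2E !mx2E; split; first by ring.
  by rewrite invr1; ring.
- move=> p Up; have Op := sub _ Up; have [_ /(W_neq0 Op) Wp] := Up.
  have H2 := second_form_g Op.
  split.
  + by have := congr1 (fun M : 'M[R]_2 => M 0 0) H2; rewrite /second_form !mx2E.
  + by have := congr1 (fun M : 'M[R]_2 => M 1 1) H2; rewrite /second_form !mx2E.
  + rewrite H2; apply: lorentzian_det; first by rewrite !mx2E.
    rewrite det2E !mx2E mul0r sub0r -expr2 oppr_lt0 exprn_even_gt0 //=.
    by rewrite !mulf_neq0 ?oppr_eq0 ?invr_neq0 // pnatr_eq0.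
- move=> p Up; have Op := sub _ Up; have [_ /(W_neq0 Op) Wp] := Up.
  rewrite /gaussian_curvature second_form_g // det_first_form // det2E !mx2E.
  rewrite mul0r sub0r.
  have -> : (- s * c * k * W p / 2) * (- s * c * k * W p / 2) =
     (s * s) * (c * k * W p / 2) ^+ 2 by field.
  by rewrite s_sqr; field; rewrite c_neq0 Wp.
Qed.

End ParallelSurface.

(** * Hyperbolic identities and the range of sinh^2 *)

Section Hyperbolic.
Context {R : realType}.
Implicit Types t r : R.

Lemma cosh2_sinh2 t : Defs.cosh t ^+ 2 = 1 + Defs.sinh t ^+ 2.
Proof.
by rewrite /Defs.cosh /Defs.sinh expRN; field; rewrite gt_eqF ?expR_gt0.
Qed.

Lemma sinh_eq0 t : (Defs.sinh t == 0) = (t == 0).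
Proof.
rewrite /Defs.sinh mulf_eq0 invr_eq0 (pnatr_eq0 R 2) orbF subr_eq0.
rewrite (inj_eq (@expR_inj R)) -subr_eq0 opprK -mulr2n.
by rewrite -mulr_natl mulf_eq0 (pnatr_eq0 R 2).
Qed.

(** The witness is arsinh q = ln (q + w) with q = sqrt r and w = sqrt (q^2 + 1); since w^2 - q^2 =
    1, the inverse of q + w is w - q. *)
Lemma sinh2_surj r : 0 < r -> exists2 t, t != 0 & Defs.sinh t ^+ 2 = r.
Proof.
move=> r0; pose q := Num.sqrt r; pose w := Num.sqrt (r + 1).
have q2 : q ^+ 2 = r by rewrite sqr_sqrtr // ltW.
have w2 : w ^+ 2 = q ^+ 2 + 1 by rewrite q2 sqr_sqrtr //; lra.
have q0 : 0 <= q by exact: sqrtr_ge0.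
have w0 : 0 < w by rewrite sqrtr_gt0; lra.
have e : expR (ln (q + w)) = q + w by rewrite lnK // posrE; lra.
have st : Defs.sinh (ln (q + w)) = q.
  have -> : Defs.sinh (ln (q + w)) = (q + w - (q + w)^-1) / 2.
    by rewrite /Defs.sinh expRN e.
  have -> : (q + w)^-1 = w - q.
    have qw : q + w != 0 by rewrite gt_eqF //; lra.
    apply: (mulfI qw); rewrite mulfV //.
    have -> : (q + w) * (w - q) = w ^+ 2 - q ^+ 2 by ring.
    by rewrite w2; ring.
  by field.
exists (ln (q + w)); last by rewrite st.
rewrite -sinh_eq0 st; apply: contraTneq r0 => q00.
by rewrite -q2 q00 expr0n ltxx.
Qed.

End Hyperbolic.

(** * The surfaces g_+ and g_- of a regular frame *)

Section FrameSurfaces.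
Context {R : realType} {Omega : set 'rV[R]_2} {Fh : R -> 'rV[R]_2 -> 'M[R]_2}.
Context {A1 A2 A3 B1 B2 B3 : 'rV[R]_2 -> R}.
Hypothesis Omega_open : open Omega.
Hypothesis Fh_frame : frame_with_coefs Omega Fh A1 A2 A3 B1 B2 B3.
Hypothesis B2_neq0 : forall p, Omega p -> B2 p != 0.

Let smooth_Fh l : l != 0 -> smooth_on Omega (Fh l).
Proof.
move=> l0; have [Fs _ _ _] := Fh_frame.
by apply: (smooth_on_slice (f := fun q => Fh q.2 q.1) (l := l) _ Fs) => p Op.
Qed.

Let det_Fh l p : l != 0 -> Omega p -> \det (Fh l p) = 1.
Proof. by have [_ + _ _] := Fh_frame; apply. Qed.

Let Fh_unit l p : l != 0 -> Omega p -> Fh l p \in unitmx.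
Proof. by move=> l0 Op; rewrite unitmxE det_Fh // unitr1. Qed.

Let dx_Fh l p : l != 0 -> Omega p ->
  dx (Fh l) p = Fh l p *m mx2 (- A3 p) (A2 p) (l * A1 p) (A3 p).
Proof.
move=> l0 Op; have [_ _ Fx _] := Fh_frame.
rewrite -[LHS](mulKVmx (Fh_unit l0 Op)) Fx //; congr (_ *m _).
by apply: mx2P; rewrite !mxE /=; ring.
Qed.

Let dy_Fh l p : l != 0 -> Omega p ->
  dy (Fh l) p = Fh l p *m mx2 (- B3 p) (l^-1 * B2 p) (B1 p) (B3 p).
Proof.
move=> l0 Op; have [_ _ _ Fy] := Fh_frame.
rewrite -[LHS](mulKVmx (Fh_unit l0 Op)) Fy //; congr (_ *m _).
by apply: mx2P; rewrite !mxE /=; ring.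
Qed.

Variable theta : R.
Hypothesis theta_neq0 : theta != 0.

Let u : R := expR theta.
Let u_neq0 : u != 0. Proof. by rewrite gt_eqF ?expR_gt0. Qed.
Let lE : expR (4 * theta) = u ^+ 4. Proof. by rewrite expRM_natl. Qed.
Let l_neq0 : expR (4 * theta) != 0. Proof. by rewrite gt_eqF ?expR_gt0. Qed.
Let sinhE : Defs.sinh theta = (u - u^-1) / 2.
Proof. by rewrite /Defs.sinh expRN. Qed.
Let coshE : Defs.cosh theta = (u + u^-1) / 2.
Proof. by rewrite /Defs.cosh expRN. Qed.
(** This is 2 sinh theta. In these two names [s] and [c] refer to sinh and cosh, not to the sign and
    the factor of the preceding section. *)
Let s_neq0 : u - u^-1 != 0.
Proof.
rewrite -[_ - _](mulfVK (_ : 2 != 0)) ?pnatr_eq0 // -sinhE.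
by rewrite mulf_neq0 ?pnatr_eq0 ?sinh_eq0.
Qed.
Let c_neq0 : u + u^-1 != 0.
Proof. by rewrite gt_eqF // addr_gt0 ?invr_gt0 ?expR_gt0. Qed.

Let dxF p : Omega p ->
  dx (Fh 1) p = Fh 1 p *m mx2 (- A3 p) (A2 p) (A1 p) (A3 p).
Proof. by move=> Op; rewrite dx_Fh ?oner_neq0 // mul1r. Qed.

Let dyF p : Omega p ->
  dy (Fh 1) p = Fh 1 p *m mx2 (- B3 p) (B2 p) (B1 p) (B3 p).
Proof. by move=> Op; rewrite dy_Fh ?oner_neq0 // invr1 mul1r. Qed.

(** The case s = 1: here c = 2 sinh theta and k = 2 cosh theta, so the curvature is coth^2 - 1. *)
Lemma g_plus_cgc :
  cgc_surface (immersed_part Omega (frame_normal Fh)) (g_plus Fh theta)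
    (frame_normal Fh) (K_plus theta).
Proof.
have -> : K_plus theta = (1 * u + u^-1) ^+ 2 / (1 * u - u^-1) ^+ 2 - 1.
  have s1 : u * u - 1 != 0.
    have -> : u * u - 1 = u * (u - u^-1) by field.
    exact: mulf_neq0.
  by rewrite /K_plus sinhE !mul1r; field; rewrite u_neq0 s1.
rewrite /g_plus expmx_e3.
apply: (parallel_surface_cgc (G := Fh (expR (4 * theta)))
  Omega_open _ _ _ _ dxF dyF) => //.
- by apply: smooth_Fh; exact: oner_neq0.
- exact: smooth_Fh.
- by move=> p Op; rewrite det_Fh ?oner_neq0.
- by move=> p Op; rewrite det_Fh.
- by move=> p Op; rewrite dx_Fh // lE !mul1r.
- by move=> p Op; rewrite dy_Fh // lE !mul1r.
- by rewrite mul1r.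
- by rewrite mul1r.
- by rewrite mul1r.
Qed.

(** The case s = -1: the roles are exchanged, c = -2 cosh theta and k = -2 sinh theta, so the
    curvature is tanh^2 - 1. *)
Lemma g_minus_cgc :
  cgc_surface (immersed_part Omega (frame_normal Fh)) (g_minus Fh theta)
    (frame_normal Fh) (K_minus theta).
Proof.
have -> : K_minus theta = (-1 * u + u^-1) ^+ 2 / (-1 * u - u^-1) ^+ 2 - 1.
  have c1 : u * u + 1 != 0.
    have -> : u * u + 1 = u * (u + u^-1) by field.
    exact: mulf_neq0.
  rewrite /K_minus coshE; field; rewrite u_neq0 c1 andbT /=.
  by rewrite mulN1r mulNr -opprD oppr_eq0.
rewrite /g_minus expmx_e3.
have det_e3 : \det (e3 R) = -1 by rewrite det2E !mx2E; ring.
pose H := Fh (expR (4 * theta)).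
have smoothG : smooth_on Omega (fun p => e3 R *m H p *m e3 R).
  apply: smooth_on_mulmx => //; last exact: smooth_on_cst.
  by apply: smooth_on_mulmx => //; [exact: smooth_on_cst|exact: smooth_Fh].
(* Moving the right-hand [e3] to the left past the coefficient matrix negates its off-diagonal
   entries, which is the source of s = -1. *)
have derG v (a b d e : R) p : Omega p -> 'D_v H p = H p *m mx2 a b d e ->
    'D_v (fun p => e3 R *m H p *m e3 R) p =
    e3 R *m H p *m e3 R *m mx2 a (- b) (- d) e.
  move=> Op DF; have Fp := smooth_on_differentiable (smooth_Fh l_neq0) Op.
  have [eFp DeF] := derive_mulmx v (differentiable_cst (e3 R) p) Fp.
  have [_ ->] := derive_cst_mulmx (e3 R) v eFp.
  rewrite DeF derive_cst mul0mx add0r DF -!mulmxA; congr (_ *m (_ *m _)).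
  by rewrite !mulmx_mx2; congr mx2; ring.
apply: (parallel_surface_cgc (G := fun p => e3 R *m H p *m e3 R)
  Omega_open _ smoothG _ _ dxF dyF) => //.
- by apply: smooth_Fh; exact: oner_neq0.
- by move=> p Op; rewrite det_Fh ?oner_neq0.
- by move=> p Op; rewrite !det_mulmx det_e3 det_Fh // mulr1 mulrNN mulr1.
- move=> p Op; rewrite /dx (derG _ _ _ _ _ _ Op (dx_Fh l_neq0 Op)) lE /u.
  by congr (_ *m mx2 _ _ _ _); ring.
- move=> p Op; rewrite /dy (derG _ _ _ _ _ _ Op (dy_Fh l_neq0 Op)) lE /u.
  by congr (_ *m mx2 _ _ _ _); ring.
- by rewrite mulrNN mulr1.
- by rewrite mulN1r -opprD oppr_eq0.
- by rewrite mulN1r addrC -opprB oppr_eq0.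
Qed.

End FrameSurfaces.

(** * Bounds on the two curvatures, and solving for theta when K is prescribed *)

Unset Implicit Arguments.

Theorem theorem5p9 (R : realType) (Omega : set 'rV[R]_2)
    (Fh : R -> 'rV[R]_2 -> 'M[R]_2)
    (Omega_dom : plane_domain Omega)
    (Fh_reg : regular_admissible_frame Omega Fh) :
  (forall theta : R, theta != 0 ->
    [/\ cgc_surface (immersed_part Omega (frame_normal Fh))
          (g_plus Fh theta) (frame_normal Fh) (K_plus theta),
        cgc_surface (immersed_part Omega (frame_normal Fh))
          (g_minus Fh theta) (frame_normal Fh) (K_minus theta),
        0 < K_plus theta &
        -1 < K_minus theta < 0]) /\
  (forall K : R, -1 < K < 0 \/ 0 < K ->
    exists2 theta : R, theta != 0 &
      (K = K_plus theta /\
       cgc_surface (immersed_part Omega (frame_normal Fh))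
         (g_plus Fh theta) (frame_normal Fh) K) \/
      (K = K_minus theta /\
       cgc_surface (immersed_part Omega (frame_normal Fh))
         (g_minus Fh theta) (frame_normal Fh) K)).
Proof.
have Omega_open := proj1 Omega_dom.
have [A1 [A2 [A3 [B1 [B2 [B3 [Fh_frame AB]]]]]]] := Fh_reg.
have B2_neq0 p : Omega p -> B2 p != 0 by move=> /AB[].
split=> [theta theta0|K].
  have s2 : 0 < Defs.sinh theta ^+ 2 by rewrite exprn_even_gt0 //= sinh_eq0.
  split.
  - exact: (g_plus_cgc Omega_open Fh_frame B2_neq0 theta0).
  - exact: (g_minus_cgc Omega_open Fh_frame B2_neq0 theta0).
  - by rewrite /K_plus invr_gt0.
  - rewrite /K_minus cosh2_sinh2 oppr_lt0 ltrN2 invr_gt0 invf_lt1; lra.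
move=> [/andP[K1 K0]|K0].
  (* Solving K = - 1 / cosh^2 with cosh^2 = 1 + sinh^2; the right-hand side is positive exactly
     because -1 < K < 0. *)
  have [theta theta0 s2] : exists2 t, t != 0 & Defs.sinh t ^+ 2 = - K^-1 - 1.
    apply: sinh2_surj; rewrite subr_gt0 -invrN invf_gt1; lra.
  exists theta => //; right.
  have KE : K = K_minus theta.
    by rewrite /K_minus cosh2_sinh2 s2 addrC subrK invrN invrK opprK.
  split => //; rewrite KE.
  exact: (g_minus_cgc Omega_open Fh_frame B2_neq0 theta0).
have [theta theta0 s2] : exists2 t, t != 0 & Defs.sinh t ^+ 2 = K^-1.
  by apply: sinh2_surj; rewrite invr_gt0.
exists theta => //; left.
have KE : K = K_plus theta by rewrite /K_plus s2 invrK.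
split => //; rewrite KE.
exact: (g_plus_cgc Omega_open Fh_frame B2_neq0 theta0).
Qed.
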